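(* Let $\rho$ be a left-continuous convex modular on a real vector space $X$, let $X_\rho$ be the associated modular space, and let $\tau_{\rho}$ and $\tau_{\|\cdot\|_{\rho}}$ be, respectively, the modular topology and the Luxemburg norm topology on $X_\rho$. Then the following conditions are equivalent: (i) $\tau_{\rho}$ is a topological vector space topology on $X_{\rho}$ (i.e. addition $X_\rho\times X_\rho\to X_\rho$ and scalar multiplication $\mathbb{R}\times X_\rho\to X_\rho$ are continuous for $\tau_\rho$). (ii) $\rho$ satisfies the $\Delta_2$-condition. (iii) $\|\cdot\|_{\rho}$-convergence is equivalent to $\rho$-convergence, i.e. for every sequence $(x_j)\subset X_\rho$ and $x\in X_\rho$, $\|x_j-x\|_\rho\to 0$ if and only if $\rho(x_j-x)\to 0$. (iv) $\tau_{\|\cdot\|_{\rho}} = \tau_{\rho}$. (v) $(X_{\rho}, \tau_{\rho})$ is normable, i.e. $\tau_\rho$ is the topology induced by some norm on $X_\rho$.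
   Context: A (convex) modular on a real vector space $X$ is a functional $\rho:X\to[0,\infty]$ such that (1) $\rho(u)=0$ iff $u=0$; (2) $\rho(\alpha u)=\rho(u)$ if $|\alpha|=1$; (3) $\rho(\alpha u+(1-\alpha)v)\le\alpha\rho(u)+(1-\alpha)\rho(v)$ for all $\alpha\in[0,1]$, $u,v\in X$. It is left-continuous if $\lim_{\lambda\to\lambda_0^-}\rho(\lambda u)=\rho(\lambda_0u)$ for every $u\in X$ and $\lambda_0>0$. The modular space is the vector subspace $X_\rho=\{v\in X:\rho(\lambda v)<\infty\text{ for some }\lambda>0\}$. The Luxemburg norm on $X_\rho$ is $\|x\|_\rho=\inf\{\lambda>0:\rho(\lambda^{-1}x)\le1\}$. A sequence $(x_j)$ $\rho$-converges to $x$ if $\rho(x_j-x)\to0$. The modular ball is $B_{\rho,\varepsilon}(x)=\{y\in X:\rho(y-x)<\varepsilon\}$ (contained in $X_\rho$ when $x\in X_\rho$). The modular topology $\tau_\rho$ on $X_\rho$: a set $A\subseteq X_\rho$ is $\tau_\rho$-open iff for every $x\in A$ there is $\varepsilon>0$ with $B_{\rho,\varepsilon}(x)\subset A$. (Modular balls are not asserted to be $\tau_\rho$-open.) $\rho$ satisfies the $\Delta_2$-condition if for every sequence $(x_j)\subset X$, $\rho(x_j)\to0$ implies $\rho(2x_j)\to0$. *)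

(* Defs.v *)
From HB Require Import structures.
From mathcomp Require Import all_boot all_order all_algebra.
From mathcomp Require Import all_classical all_reals all_analysis.
From mathcomp Require Import ring lra.

Set Implicit Arguments.
Unset Strict Implicit.
Unset Printing Implicit Defensive.

Import Order.TTheory GRing.Theory Num.Theory.
Import numFieldNormedType.Exports.

Local Open Scope classical_set_scope.
Local Open Scope ring_scope.

(* At a = 0 or a = 1 the right-hand side of [modular_convex] is read with the
   convention 0 * +oo = 0. *)
HB.mixin Record isConvexModular (R : realType) (X : lmodType R)
    (rho : X -> \bar R) := {
  modular_ge0 : forall u, (0 <= rho u)%E ;
  modular_eq0 : forall u, rho u = 0%E <-> u = 0 ;
  modular_symm : forall (a : R) u, `|a| = 1 -> rho (a *: u) = rho u ;
  modular_convex : forall (a : R) (u v : X), 0 <= a <= 1 ->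
    (rho (a *: u + (1 - a) *: v)%R <= a%:E * rho u + (1 - a)%:E * rho v)%E
}.

#[short(type="convexModular")]
HB.structure Definition ConvexModular (R : realType) (X : lmodType R) :=
  {rho of @isConvexModular R X rho}.

Arguments modular_ge0 {R X} s u.
Arguments modular_eq0 {R X} s u.
Arguments modular_symm {R X} s a u.
Arguments modular_convex {R X} s a u v.

Definition left_continuous_modular (R : realType) (X : lmodType R)
    (rho : X -> \bar R) :=
  forall (u : X) (l0 : R), 0 < l0 ->
    rho (l *: u) @[l --> l0^'-] --> rho (l0 *: u).

Definition Delta2 (R : realType) (X : lmodType R) (rho : X -> \bar R) :=
  forall x : nat -> X,
    rho (x j) @[j --> \oo] --> 0%E -> rho (2 *: x j) @[j --> \oo] --> 0%E.

Definition modular_ball (R : realType) (X : lmodType R) (rho : X -> \bar R)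
    (x : X) (e : R) : set X :=
  [set y | (rho (y - x)%R < e%:E)%E].

Definition modular_space (R : realType) (X : lmodType R) (rho : X -> \bar R)
    : {pred X} :=
  fun v => `[< exists2 l : R, 0 < l & (rho (l *: v) < +oo)%E >].

Section ModularTheory.
Context (R : realType) (X : lmodType R) (rho : convexModular X).

Lemma modular0 : rho 0 = 0%E.
Proof. exact/modular_eq0. Qed.

Lemma modularN u : rho (- u) = rho u.
Proof. by rewrite -scaleN1r modular_symm// normrN1. Qed.

Lemma modular_scale_le (a : R) u : 0 <= a <= 1 ->
  (rho (a *: u) <= a%:E * rho u)%E.
Proof.
move=> a01; have := modular_convex rho a u 0 a01.
by rewrite scaler0 addr0 modular0 mule0 adde0.
Qed.

Lemma modular_mono (a b : R) u : 0 < b -> `|a| <= b ->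
  (rho (a *: u) <= rho (b *: u))%E.
Proof.
move=> b0 ab.
have -> : rho (a *: u) = rho (`|a| *: u).
  by case: (ger0P a) => // _; rewrite scaleNr modularN.
have c01 : 0 <= `|a| / b <= 1.
  by rewrite divr_ge0 ?(ltW b0)//= ler_pdivrMr// mul1r.
have -> : `|a| *: u = (`|a| / b) *: (b *: u).
  by rewrite scalerA divfK// gt_eqF.
apply: le_trans (modular_scale_le _ c01) _.
by apply: gee_pMl; rewrite ?lee_fin//; [exact: modular_ge0|case/andP: c01].
Qed.

Lemma modular_space_submod_closed : submod_closed (modular_space rho).
Proof.
split=> [|a u v /asboolP[k k0 ku] /asboolP[m m0 mv]]; apply/asboolP.
  by exists 1 => //; rewrite scaler0 modular0.
pose s : R := 2 * (`|a| / k + m^-1).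
have q0 : 0 <= `|a| / k by rewrite divr_ge0 // ltW.
have s0 : 0 < s by rewrite mulr_gt0// ltr_wpDl// invr_gt0.
exists s^-1; first by rewrite invr_gt0.
have -> : s^-1 *: (a *: u + v)
    = 2^-1 *: ((2 * s^-1 * a) *: u) + (1 - 2^-1) *: ((2 * s^-1) *: v).
  rewrite scalerDr !scalerA; congr (_ *: _ + _ *: _).
    by rewrite -mulrA mulKf// pnatr_eq0.
  by rewrite [1 - _](_ : _ = 2^-1); [rewrite mulKf// pnatr_eq0|field].
have h01 : 0 <= (2^-1 : R) <= 1 by apply/andP; split; lra.
apply: le_lt_trans (modular_convex rho _ _ _ h01) _.
have h1 : (rho ((2 * s^-1 * a) *: u) < +oo)%E.
  apply: le_lt_trans ku; apply: modular_mono => //.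
  rewrite !normrM normfV (gtr0_norm s0) ger0_norm// mulrAC.
  rewrite ler_pdivrMr// /s mulrA [k * 2]mulrC -mulrA ler_pM2l//.
  by rewrite mulrDr mulrCA divff ?gt_eqF// mulr1 lerDl divr_ge0// ltW.
have h2 : (rho ((2 * s^-1) *: v) < +oo)%E.
  apply: le_lt_trans mv; apply: modular_mono => //.
  rewrite normrM normfV (gtr0_norm s0) ger0_norm//.
  rewrite ler_pdivrMr// /s mulrCA -[leLHS]mulr1 ler_pM2l//.
  by rewrite mulrDr divff ?gt_eqF// lerDr mulr_ge0// ltW.
have fin w : (rho w < +oo)%E -> rho w \is a fin_num.
  by move=> w_oo; rewrite ge0_fin_numE// modular_ge0.
by rewrite -(fineK (fin _ h1)) -(fineK (fin _ h2)) -!EFinM -EFinD ltry.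
Qed.

HB.instance Definition _ := GRing.isSubmodClosed.Build R X (modular_space rho)
  modular_space_submod_closed.

Record modularType := ModularElt {
  modular_val :> X ;
  modular_valP : modular_val \in modular_space rho }.

HB.instance Definition _ := [isSub for modular_val].
HB.instance Definition _ := [Choice of modularType by <:].
HB.instance Definition _ := [SubChoice_isSubLmodule of modularType by <:].

Lemma modular_val0 : modular_val 0 = 0.
Proof. by []. Qed.

Lemma modular_valD : {morph modular_val : x y / x + y}.
Proof. by []. Qed.

Lemma modular_valZ (a : R) : {morph modular_val : x / a *: x}.
Proof. by []. Qed.

End ModularTheory.

(* The type [modularType rho] only carries the vector space structure of the
   modular space; its topologies live on aliases. *)

Section ModularTopology.
Context (R : realType) (X : lmodType R) (rho : convexModular X).

(* The ball is a subset of X, hence the comparison with the image of A in X. *)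
Definition modular_open : set_system (modularType rho) :=
  [set A | forall x, A x -> exists2 e : R, 0 < e &
    modular_ball rho (modular_val x) e `<=` @modular_val R X rho @` A].

Lemma modular_open_setT : modular_open setT.
Proof.
move=> x _; exists 1 => // y xy1.
suff yM : y \in modular_space rho by exists (ModularElt yM).
rewrite -(subrK (val x) y) rpredD ?(valP x)//.
by apply/asboolP; exists 1 => //; rewrite scale1r (lt_trans xy1)// ltry.
Qed.

Lemma modular_open_setI : setI_closed modular_open.
Proof.
move=> A B oA oB x [/oA[e e0 xA] /oB[f f0 xB]].
exists (Num.min e f); first by rewrite lt_min e0.
move=> y xy.
have [|a Aa ay] := xA y.
  by apply: lt_le_trans xy _; rewrite lee_fin ge_min lexx.
have [|b Bb yb] := xB y.
  by apply: lt_le_trans xy _; rewrite lee_fin ge_min lexx orbT.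
by exists a => //; split=> //; rewrite (_ : a = b)//; apply: val_inj; rewrite /= ay.
Qed.

Lemma modular_open_bigcup (I : Type) (f : I -> set (modularType rho)) :
  (forall i, modular_open (f i)) -> modular_open (\bigcup_i f i).
Proof.
move=> of_ x [i _ /of_[e e0 xe]]; exists e => // y /xe[z fz <-].
by exists z => //; exists i.
Qed.

Definition modular_topological := modularType rho.

HB.instance Definition _ := GRing.Lmodule.on modular_topological.
HB.instance Definition _ := isOpenTopological.Build modular_topological
  modular_open_setT modular_open_setI modular_open_bigcup.

End ModularTopology.

Record vs_norm (R : realType) (V : lmodType R) := VSNorm {
  vs_norm_fun :> V -> R ;
  vs_normD : forall x y, vs_norm_fun (x + y) <= vs_norm_fun x + vs_norm_fun y ;
  vs_normZ : forall (a : R) x, vs_norm_fun (a *: x) = `|a| * vs_norm_fun x ;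
  vs_norm0_eq0 : forall x, vs_norm_fun x = 0 -> x = 0 }.

(* V seen as a normed module, with the norm N and the topology of N. *)
Definition normed_by (R : realType) (V : lmodType R) (N : vs_norm V) : Type := V.

Section NormedBy.
Context (R : realType) (V : lmodType R) (N : vs_norm V).

HB.instance Definition _ := GRing.Lmodule.on (normed_by N).
HB.instance Definition _ := Lmodule_isNormed.Build R (normed_by N)
  (vs_normD N) (vs_normZ N) (@vs_norm0_eq0 _ _ N).

End NormedBy.

Section LuxemburgNorm.
Context (R : realType) (X : lmodType R) (rho : convexModular X).
Implicit Types x y : modularType rho.

Definition luxemburg_set x : set R :=
  [set l | 0 < l /\ (rho (l^-1 *: modular_val x) <= 1)%E].

Definition luxemburg_norm x : R := inf (luxemburg_set x).

Lemma luxemburg_set_lbound x : lbound (luxemburg_set x) 0.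
Proof. by move=> l [/ltW]. Qed.

Lemma luxemburg_set_neq0 x : luxemburg_set x !=set0.
Proof.
have /asboolP[c c0 cx] := valP x.
have fx : rho (c *: val x) \is a fin_num.
  by rewrite ge0_fin_numE// modular_ge0.
pose r := fine (rho (c *: val x)).
have r0 : 0 <= r by rewrite fine_ge0// modular_ge0.
have r1 : 0 < r + 1 by rewrite ltr_wpDl.
exists ((r + 1) / c); split; first by rewrite divr_gt0.
rewrite invf_div mulrC -scalerA.
apply: le_trans (modular_scale_le _ _ _) _.
  by rewrite invr_ge0 ltW//= invf_le1// lerDr.
by rewrite -(fineK fx) -EFinM lee_fin mulrC ler_pdivrMr// mul1r lerDl.
Qed.

Lemma luxemburg_norm_le x l : luxemburg_set x l -> luxemburg_norm x <= l.
Proof. by apply: ge_inf; exists 0; exact: luxemburg_set_lbound. Qed.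

Lemma le_luxemburg_norm x a :
  (forall l, luxemburg_set x l -> a <= l) -> a <= luxemburg_norm x.
Proof. by move=> xa; apply: lb_le_inf xa; exact: luxemburg_set_neq0. Qed.

Lemma luxemburg_norm_ge0 x : 0 <= luxemburg_norm x.
Proof. exact/le_luxemburg_norm/luxemburg_set_lbound. Qed.

Lemma luxemburg_normD x y :
  luxemburg_norm (x + y) <= luxemburg_norm x + luxemburg_norm y.
Proof.
rewrite -lerBlDr; apply: le_luxemburg_norm => a [a0 xa].
rewrite lerBlDr -lerBlDl; apply: le_luxemburg_norm => b [b0 yb].
rewrite lerBlDl; apply: luxemburg_norm_le.
have ab0 : 0 < a + b by rewrite addr_gt0.
split => //.
have -> : (a + b)^-1 *: modular_val (x + y) =
    (a / (a + b)) *: (a^-1 *: modular_val x)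
    + (1 - a / (a + b)) *: (b^-1 *: modular_val y).
  rewrite modular_valD scalerDr !scalerA; congr (_ *: _ + _ *: _); field.
    by rewrite !gt_eqF.
  by rewrite !gt_eqF.
have t01 : 0 <= a / (a + b) <= 1.
  by rewrite divr_ge0 ?(ltW a0) ?(ltW ab0)//= ler_pdivrMr// mul1r lerDl ltW.
apply: le_trans (modular_convex rho _ _ _ t01) _.
have -> : (1 = (a / (a + b))%:E * 1 + (1 - a / (a + b))%:E * 1 :> \bar R)%E.
  by rewrite !mule1 -EFinD subrKC.
case/andP: t01 => t0 t1.
by apply: leeD; apply: lee_wpmul2l => //; rewrite lee_fin ?subr_ge0.
Qed.

Lemma luxemburg_normZ_le (a : R) x : a != 0 ->
  luxemburg_norm (a *: x) <= `|a| * luxemburg_norm x.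
Proof.
move=> a0; have na0 : 0 < `|a| by rewrite normr_gt0.
rewrite mulrC -ler_pdivrMr//; apply: le_luxemburg_norm => l [l0 xl].
rewrite ler_pdivrMr//; apply: luxemburg_norm_le; split.
  by rewrite mulr_gt0.
apply: le_trans xl; rewrite modular_valZ scalerA; apply: modular_mono.
  by rewrite invr_gt0.
rewrite invfM !normrM !normfV normr_id (gtr0_norm l0) mulfVK//.
exact: lt0r_neq0.
Qed.

Lemma luxemburg_norm0 : luxemburg_norm 0 = 0.
Proof.
apply/eqP; rewrite eq_le luxemburg_norm_ge0 andbT.
apply/ler_addgt0Pr => e e0; rewrite add0r; apply: luxemburg_norm_le.
split=> //.
by rewrite modular_val0 scaler0 modular0.
Qed.

Lemma luxemburg_normZ (a : R) x :
  luxemburg_norm (a *: x) = `|a| * luxemburg_norm x.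
Proof.
have [->|a0] := eqVneq a 0.
  by rewrite scale0r luxemburg_norm0 normr0 mul0r.
apply/eqP; rewrite eq_le luxemburg_normZ_le//=.
have na0 : 0 < `|a| by rewrite normr_gt0.
rewrite mulrC -ler_pdivlMr// mulrC -normfV.
have := @luxemburg_normZ_le a^-1 (a *: x).
by rewrite scalerA mulVf// scale1r invr_eq0 => /(_ a0).
Qed.

Lemma luxemburg_norm0_eq0 x : luxemburg_norm x = 0 -> x = 0.
Proof.
move=> nx0; apply: val_inj => /=.
apply/(modular_eq0 rho)/eqP; rewrite eq_le modular_ge0 andbT.
apply/lee_addgt0Pr => e e0; rewrite add0e.
have e'0 : 0 < Num.min e 1 by rewrite lt_min e0 ltr01.
have [l [l0 xl]] : exists2 l, luxemburg_set x l & l < Num.min e 1.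
  apply: inf_lt; first exact: luxemburg_set_neq0.
  by rewrite -/(luxemburg_norm x) nx0.
rewrite lt_min => /andP[le l1].
rewrite -[val x]scale1r -(mulfV (lt0r_neq0 l0)) -scalerA.
apply: le_trans (modular_scale_le _ _ _) _; first by rewrite !ltW.
apply: (@le_trans _ _ (l%:E * 1)%E); last by rewrite mule1 lee_fin ltW.
by apply: lee_wpmul2l => //; rewrite lee_fin ltW.
Qed.

Definition luxemburg : vs_norm (modularType rho) :=
  VSNorm luxemburg_normD luxemburg_normZ luxemburg_norm0_eq0.

End LuxemburgNorm.

Arguments luxemburg {R X} rho.

Definition tvs_topology (R : realType) (V : preTopologicalLmodType R) :=
  continuous (fun z : V * V => z.1 + z.2) /\
  continuous (fun z : R^o * V => z.1 *: z.2).

(* Main.v *)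
Require Import Defs.
From HB Require Import structures.
From mathcomp Require Import all_boot all_order all_algebra.
From mathcomp Require Import all_classical all_reals all_analysis.
From mathcomp Require Import ring lra.

Import Order.TTheory GRing.Theory Num.Theory.
Import numFieldNormedType.Exports.

Local Open Scope classical_set_scope.
Local Open Scope ring_scope.

(** The substantial step is from a vector topology to Delta_2. Suppose
    rho (x_j) --> 0 and fix d > 0. The points 2 x_j with rho (2 x_j) >= d form a
    closed set for the modular topology: they stay at distance d from 0, and if
    y is nonzero then rho (y / 4) <= (rho (2 x_j - y) + rho (x_j)) / 2 by
    convexity, so they stay away from y for large j. The complement is an open
    neighbourhood of 0, and continuity of scaling at (2, 0) forces 2 x_j into it
    for large j, that is, rho (2 x_j) < d. *)

(** * Convergence to zero for the modular and for the Luxemburg norm *)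

Lemma cvge0P {R : realType} {u : nat -> \bar R} : (forall j, (0 <= u j)%E) ->
  u j @[j --> \oo] --> 0%E <->
  (forall e : R, 0 < e -> \forall j \near \oo, (u j < e%:E)%E).
Proof.
move=> u0; split=> [ucvg e e0|ue].
  apply: (ucvg [set z | (z < e%:E)%E]).
  by apply: open_nbhs_nbhs; split; [exact: open_ereal_lt_ereal|rewrite /= lte_fin].
(* [fine_cvgP] asks for eventually finite values; the bound 1 gives this, since [u] may take the
   value [+oo] at first. *)
have ufin : \forall j \near \oo, u j \is a fin_num.
  have := ue 1 ltr01; apply: filterS => j uj.
  by rewrite ge0_fin_numE// (lt_trans uj)// ltry.
apply/fine_cvgP; split=> //; apply/cvgr0Pnorm_lt => e e0.
near=> j; rewrite ger0_norm ?fine_ge0//= -lte_fin fineK; last by near: j.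
by near: j; exact: ue.
Unshelve. all: by end_near. Qed.

Section ModularConvergence.
Context {R : realType} {X : lmodType R} {rho : convexModular X}.

Lemma modular_space_fin u : (rho u < +oo)%E -> u \in modular_space rho.
Proof. by move=> u_oo; apply/asboolP; exists 1; rewrite ?scale1r. Qed.

Lemma modular_gt0 u : u != 0 -> (0 < rho u)%E.
Proof.
move=> u0; rewrite lt_neqAle modular_ge0 andbT eq_sym.
by apply: contra u0 => /eqP/(modular_eq0 rho)/eqP.
Qed.

(** Some l < e satisfies rho (x / l) <= 1. As l <= 1, it can serve as a convex coefficient between x
    / l and 0, so rho x <= l * rho (x / l) <= l. *)
Lemma luxemburg_modular_le {x : modularType rho} {e : R} :
  e <= 1 -> luxemburg_norm x < e -> (rho (modular_val x) < e%:E)%E.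
Proof.
move=> e1 xe; have [l [l0 xl] le] := inf_lt (luxemburg_set_neq0 x) xe.
apply: le_lt_trans (_ : (l%:E < e%:E)%E); last by rewrite lte_fin.
rewrite -[modular_val x]scale1r -(mulfV (lt0r_neq0 l0)) -scalerA.
apply: le_trans (modular_scale_le _ _ _) _; first by rewrite !ltW// (lt_le_trans le).
rewrite -[leRHS]mule1; apply: lee_wpmul2l => //.
by rewrite lee_fin ltW.
Qed.

Lemma luxemburg_cvg_modular {x : nat -> modularType rho} :
  luxemburg rho (x j) @[j --> \oo] --> 0 ->
  rho (modular_val (x j)) @[j --> \oo] --> 0%E.
Proof.
move=> x0; apply/cvge0P => [j|e e0]; first exact: modular_ge0.
have m0 : 0 < Num.min e 1 by rewrite lt_min e0 ltr01.
have /cvgr0Pnorm_lt/(_ _ m0) := x0; apply: filterS => j.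
rewrite ger0_norm ?luxemburg_norm_ge0// => xj.
apply: lt_le_trans (luxemburg_modular_le _ xj) _.
  by rewrite ge_min lexx orbT.
by rewrite lee_fin ge_min lexx.
Qed.

Lemma Delta2_expn (x : nat -> X) k : Delta2 rho ->
  rho (x j) @[j --> \oo] --> 0%E ->
  rho (2 ^+ k *: x j) @[j --> \oo] --> 0%E.
Proof.
move=> D x0; elim: k => [|k /D]; first by under eq_fun do rewrite expr0 scale1r.
by under eq_fun do rewrite scalerA -exprS.
Qed.

(** The norm of x_j is at most 2^-k as soon as rho (2^k x_j) <= 1, and iterating Delta_2 k times
    makes this hold for large j. *)
Lemma Delta2_luxemburg_cvg (x : nat -> modularType rho) : Delta2 rho ->
  rho (modular_val (x j)) @[j --> \oo] --> 0%E ->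
  luxemburg rho (x j) @[j --> \oo] --> 0.
Proof.
move=> D x0; apply/cvgr0Pnorm_lt => e e0.
have [k ke] : exists k, 2^-1 ^+ k < e.
  have [n _ /(_ n (leqnn n)) ne] := near_infty_natSinv_expn_lt (PosNum e0).
  by exists n; rewrite exprVn -div1r.
have /cvge0P : rho (2 ^+ k *: modular_val (x j)) @[j --> \oo] --> 0%E.
  exact: Delta2_expn.
move=> /(_ (fun=> modular_ge0 _ _) 1 ltr01); apply: filterS => j xj.
rewrite ger0_norm ?luxemburg_norm_ge0//; apply: le_lt_trans ke.
apply: luxemburg_norm_le; split; first by rewrite exprn_gt0// invr_gt0.
by rewrite exprVn invrK ltW.
Qed.

(** * Open sets of the two topologies *)

Lemma modular_nbhs {x : modular_topological rho}
    {A : set (modular_topological rho)} :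
  nbhs x A -> exists2 e : R, 0 < e &
    forall z : modularType rho,
      (rho (modular_val z - modular_val x)%R < e%:E)%E -> A z.
Proof.
rewrite nbhsE => -[B [oB Bx] BA].
have [e e0 xe] := oB x Bx.
exists e => // z /xe[w Bw wz]; apply: BA.
by rewrite (_ : z = w)//; apply: val_inj; rewrite /= wz.
Qed.

Lemma modular_openP (A : set (modular_topological rho)) :
  open A <-> forall x : modularType rho, A x -> exists2 e : R, 0 < e &
    forall z : modularType rho,
      (rho (modular_val z - modular_val x)%R < e%:E)%E -> A z.
Proof.
split=> [oA x Ax|oA].
  exact: modular_nbhs (open_nbhs_nbhs (conj oA Ax)).
suff : modular_open A by [].
move=> x /oA[e e0 xe]; exists e => // y xy.
(* [modular_open] uses balls of X, but a point at finite modular distance from x already lies in the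
   modular space. *)
have yM : y \in modular_space rho.
  rewrite -(subrK (modular_val x) y) rpredD ?(modular_valP x)//.
  by rewrite modular_space_fin// (lt_trans xy)// ltry.
by exists (ModularElt yM) => //; exact: xe.
Qed.

Lemma normed_openP (N : vs_norm (modularType rho)) (A : set (normed_by N)) :
  open A <-> forall x : modularType rho, A x -> exists2 e : R, 0 < e &
    forall z : modularType rho, N (z - x) < e -> A z.
Proof.
rewrite openE; split=> [oA x Ax|oA x /oA[e e0 xe]].
  have [e e0 xe] := (@nbhs_normP _ (normed_by N) x A).1 (oA x Ax).
  by exists e => // z zx; apply: xe; rewrite /= distrC.
apply/(@nbhs_normP _ (normed_by N) x A).
by exists e => // z; rewrite /= distrC; exact: xe.
Qed.

(** The norm ball of radius min(e, 1) lies in the modular ball of radius e, so this inclusion holds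
    without Delta_2. *)
Lemma modular_open_luxemburg (A : set (modularType rho)) :
  @open (modular_topological rho) A -> @open (normed_by (luxemburg rho)) A.
Proof.
move=> /modular_openP oA; apply/normed_openP => x /oA[e e0 xe].
exists (Num.min e 1) => [|z zx]; first by rewrite lt_min e0 ltr01.
apply: xe; apply: lt_le_trans (_ : ((Num.min e 1)%:E <= _)%E).
  by apply: (@luxemburg_modular_le (z - x)) => //; rewrite ge_min lexx orbT.
by rewrite lee_fin ge_min lexx.
Qed.

(** If no modular ball around x lies in A, choosing a point outside A at modular distance less than
    1/(n+1) for each n gives a sequence tending to x in the norm, against norm openness. *)
Lemma luxemburg_open_modular (A : set (modularType rho)) :
  (forall x : nat -> modularType rho,
    rho (modular_val (x j)) @[j --> \oo] --> 0%E ->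
    luxemburg rho (x j) @[j --> \oo] --> 0) ->
  @open (normed_by (luxemburg rho)) A -> @open (modular_topological rho) A.
Proof.
move=> rho_lux /normed_openP oA; apply/modular_openP => x Ax.
apply: contrapT => nAx.
have /choice[y yA] : forall n, exists y : modularType rho,
    (rho (modular_val y - modular_val x)%R < n.+1%:R^-1%:E)%E /\ ~ A y.
  move=> n; apply: contrapT => nA; apply: nAx.
  exists n.+1%:R^-1; first by rewrite invr_gt0.
  by move=> z zx; apply: contrapT => nAz; apply: nA; exists z.
have [e e0 xe] := oA x Ax.
have : rho (modular_val (y j - x)) @[j --> \oo] --> 0%E.
  apply/cvge0P => [j|d d0]; first exact: modular_ge0.
  have := near_infty_natSinv_lt (PosNum d0); apply: filterS => j jd.
  by apply: lt_trans (yA j).1 _; rewrite lte_fin.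
move=> /rho_lux/cvgr0Pnorm_lt/(_ _ e0)[n _ /(_ n (leqnn n))] /=.
rewrite ger0_norm ?luxemburg_norm_ge0// => /xe.
by have [] := yA n.
Qed.

(** * From a vector topology to Delta_2 *)

Lemma modular_quarter_le (x y : X) :
  (rho (4^-1 *: y) <= 2^-1%:E * (rho (2 *: x - y)%R + rho x))%E.
Proof.
have h01 : 0 <= (2^-1 : R) <= 1 by apply/andP; split; lra.
(* y / 4 is the midpoint of (y - 2 x) / 2 and x; this way rho (2 x), which is not known to be small,
   never enters the bound. *)
have -> : 4^-1 *: y = 2^-1 *: (2^-1 *: (y - 2 *: x)) + (1 - 2^-1) *: x.
  rewrite scalerBr scalerA mulVf ?pnatr_eq0// scale1r scalerBr scalerA.
  rewrite (_ : 1 - 2^-1 = 2^-1 :> R) ?subrK; last by field.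
  by congr (_ *: _); field.
apply: le_trans (modular_convex rho _ _ _ h01) _.
rewrite (_ : 1 - 2^-1 = 2^-1 :> R); last by field.
rewrite -muleDr//; last by rewrite ge0_adde_def// inE modular_ge0.
apply: lee_wpmul2l; first by rewrite lee_fin; lra.
apply: leeD => //; rewrite -(modularN rho (2 *: x - y)) opprB.
by rewrite -[leRHS](congr1 rho (scale1r _)); apply: modular_mono; rewrite ?ger0_norm; lra.
Qed.

(** Modular balls are not known to be open, so the neighbourhood of 0 is not taken to be rho z < d:
    only the offending points 2 x_j are removed. *)
Lemma modular_avoid_double_open (x : nat -> X) (d : R) : 0 < d ->
  rho (x j) @[j --> \oo] --> 0%E ->
  @open (modular_topological rho)
    [set z | forall j, (d%:E <= rho (2 *: x j))%E -> modular_val z <> 2 *: x j].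
Proof.
move=> d0 x0; apply/modular_openP => y yU.
suff [e e0 ye] : exists2 e : R, 0 < e & forall j,
    (d%:E <= rho (2 *: x j))%E -> (e%:E <= rho (2 *: x j - modular_val y)%R)%E.
  exists e => // z zy j /ye; apply: contraPnot => zE.
  by rewrite -zE; apply/negP; rewrite -ltNge.
have [->|y0] := eqVneq (modular_val y) 0.
  by exists d => // j; rewrite subr0.
have q0 : (0 < rho (4^-1 *: modular_val y))%E.
  by rewrite modular_gt0// scaler_eq0 negb_or y0 andbT invr_eq0 pnatr_eq0.
(* The modular may be infinite, in which case 1 is taken as the real lower bound. *)
have [r r0 rq] : exists2 r : R, 0 < r & (r%:E <= rho (4^-1 *: modular_val y))%E.
  case: (rho _) q0 => [s|_|//]; last by exists 1; rewrite ?leey.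
  by rewrite lte_fin => s0; exists s.
have [J _ xJ] := (cvge0P (fun=> modular_ge0 _ _)).1 x0 r r0.
(* Past J, rho (x_j) < r, so rho (2 x_j - y) < r would give rho (y / 4) < (r + r) / 2 = r, contrary
   to the choice of r. Only the indices below J remain. *)
suff [e e0 ye] : exists2 e : R, 0 < e & forall j, (j < J)%N ->
    (d%:E <= rho (2 *: x j))%E -> (e%:E <= rho (2 *: x j - modular_val y)%R)%E.
  exists (Num.min e r) => [|j dj]; first by rewrite lt_min e0.
  have [jJ|Jj] := ltnP j J.
    by apply: le_trans (ye j jJ dj); rewrite lee_fin ge_min lexx.
  apply: (@le_trans _ _ r%:E); first by rewrite lee_fin ge_min lexx orbT.
  rewrite leNgt; apply/negP => yr.
  have : (r%:E < r%:E)%E; last by rewrite ltxx.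
  apply: le_lt_trans (le_trans rq (modular_quarter_le (x j) _)) _.
  rewrite (_ : r%:E = 2^-1%:E * (r%:E + r%:E))%E; last first.
    by rewrite -EFinD -EFinM; congr EFin; field.
  by rewrite lte_pmul2l ?lte_fin ?invr_gt0//; apply: lteD => //; exact: xJ.
(* A minimum of finitely many positive distances, built one index at a time; each is positive
   because y avoids the point 2 x_J. *)
elim: J {xJ} => [|J [e e0 ye]]; first by exists 1.
have [dJ|dJ] := leP d%:E (rho (2 *: x J)); last first.
  exists e => // j; rewrite ltnS leq_eqVlt => /predU1P[->|/ye//].
  by rewrite leNgt dJ.
have [s s0 sJ] : exists2 s : R, 0 < s &
    (s%:E <= rho (2 *: x J - modular_val y)%R)%E.
  have : (0 < rho (2 *: x J - modular_val y)%R)%E.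
    by apply: modular_gt0; rewrite subr_eq0 eq_sym; apply/eqP/yU.
  case: (rho _) => [s|_|//]; last by exists 1; rewrite ?leey.
  by rewrite lte_fin => s0; exists s.
exists (Num.min e s) => [|j]; first by rewrite lt_min e0.
rewrite ltnS leq_eqVlt => /predU1P[->|/ye{}ye] => [_|/ye{}ye].
  by apply: le_trans sJ; rewrite lee_fin ge_min lexx orbT.
by apply: le_trans ye; rewrite lee_fin ge_min lexx.
Qed.

Lemma tvs_topology_Delta2 : tvs_topology (modular_topological rho) -> Delta2 rho.
Proof.
move=> [_ scale_cont] x x0; apply/cvge0P => [j|d d0]; first exact: modular_ge0.
pose U : set (modularType rho) :=
  [set z | forall j, (d%:E <= rho (2 *: x j))%E -> modular_val z <> 2 *: x j].
have oU : @open (modular_topological rho) U by exact: modular_avoid_double_open.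
have U0 : U 0.
  move=> j + xj0; rewrite -xj0 modular_val0 modular0.
  by rewrite leNgt lte_fin d0.
have := scale_cont (2, 0 : modular_topological rho) U.
rewrite /= scaler0 => /(_ (open_nbhs_nbhs (conj oU U0)))[[B C] /= [B2 C0] BCU].
have [e e0 eC] := modular_nbhs C0.
have m0 : 0 < Num.min e 1 by rewrite lt_min e0 ltr01.
have := (cvge0P (fun=> modular_ge0 _ _)).1 x0 _ m0; apply: filterS => j xj.
rewrite ltNge; apply/negP => dj.
(* Delta_2 concerns sequences of X, so x_j is known to lie in the modular space only now that rho
   (x_j) is finite. *)
have xjM : x j \in modular_space rho by rewrite modular_space_fin// (lt_trans xj)// ltry.
have Cxj : C (ModularElt xjM).
  apply: eC; rewrite /= subr0 (lt_le_trans xj)// lee_fin ge_min lexx //.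
(* At the scalar 2 itself, 2 x_j lands in [U], whose condition at the index j forbids the value 2
   x_j. *)
by have := BCU (2, ModularElt xjM) (conj (nbhs_singleton B2) Cxj) j dj; apply.
Qed.

(** Both topologies live on aliases of the same vector space, so equal open sets give equal
    neighbourhoods, and the continuity of the normed operations carries over. *)
Lemma normable_tvs_topology (N : vs_norm (modularType rho)) :
  @open (normed_by N) = @open (modular_topological rho) ->
  tvs_topology (modular_topological rho).
Proof.
move=> oE.
have nbE (x : modularType rho) (A : set (modularType rho)) :
    @nbhs _ (normed_by N) x A <-> @nbhs _ (modular_topological rho) x A.
  rewrite !nbhsE; split=> -[B [oB Bx] BA]; exists B => //; split=> //.
    by rewrite -oE.
  by rewrite oE.
have addN : continuous (fun z : normed_by N * normed_by N => z.1 + z.2).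
  exact: add_continuous.
have scaleN : continuous (fun z : R^o * normed_by N => z.1 *: z.2).
  exact: scale_continuous.
split=> z A /= /nbE zA.
  have [[B C] /= [zB zC] BCA] := addN z A zA.
  by exists (B, C) => //=; split; apply/nbE.
have [[B C] /= [zB zC] BCA] := scaleN z A zA.
by exists (B, C) => //=; split=> //; apply/nbE.
Qed.

End ModularConvergence.

Theorem theorem5p1 (R : realType) (X : lmodType R) (rho : convexModular X)
    (rho_left_continuous : left_continuous_modular rho) :
  [<-> tvs_topology (modular_topological rho);
       Delta2 rho;
       forall (x : nat -> modularType rho) (y : modularType rho),
         (luxemburg rho (x j - y) @[j --> \oo] --> 0) <->
         (rho (modular_val (x j) - modular_val y) @[j --> \oo] --> 0%E);
       @open (normed_by (luxemburg rho)) = @open (modular_topological rho);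
       exists N : vs_norm (modularType rho),
         @open (normed_by N) = @open (modular_topological rho)].
Proof.
tfae.
- exact: tvs_topology_Delta2.
- move=> D x y; split=> [/luxemburg_cvg_modular//|].
  exact: (@Delta2_luxemburg_cvg _ _ _ (fun j => x j - y) D).
- move=> cvgE; apply/seteqP; split=> A; last exact: modular_open_luxemburg.
  apply: luxemburg_open_modular => x x0.
  (* The limit 0 suffices, since [luxemburg_open_modular] has already translated to the origin. *)
  have := (cvgE x 0).2.
  under eq_fun do rewrite modular_val0 subr0.
  by move=> /(_ x0); under eq_fun do rewrite subr0.
- by move=> ?; exists (luxemburg rho).
- by move=> [N]; exact: normable_tvs_topology.
Qed.
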